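(* Let $g\in\mathcal{F}_0$ and $F\in\mathcal{F}_1$. Then the Riordan matrix $(g,F)\in\mathcal{R}(\mathbb{F})$ can be factorized into almost-Riordan matrices as follows: $$(g,F)=(g,\,F/x,\,x)\,(1,\,g,\,F),$$ where the product on the right is the product of infinite lower triangular matrices.
   Context: $\mathbb{F}$ is the field of real or complex numbers. $\mathcal{F}_0$ is the set of formal power series $\sum_{i\ge 0}a_ix^i\in\mathbb{F}[[x]]$ with $a_0\neq 0$, and $\mathcal{F}_1=x\mathcal{F}_0$. For $g\in\mathcal{F}_0$, $F\in\mathcal{F}_1$, the Riordan matrix $(g,F)$ is the infinite lower triangular matrix $[a_{ij}]_{i,j\ge 0}$ with $a_{ij}=[x^i]\,g(x)F(x)^j$, where $[x^i]$ denotes the coefficient of $x^i$; $\mathcal{R}(\mathbb{F})$ is the set (a group under matrix multiplication) of all Riordan matrices. For $a,g\in\mathcal{F}_0$ and $F\in\mathcal{F}_1$, the almost-Riordan matrix (almost-Riordan array) $(a,g,F)$ is the infinite lower triangular matrix whose first column (column $0$) has generating function $a$ (entry in row $i$ is $[x^i]a$), whose row $0$ is zero outside column $0$, and whose submatrix formed by the rows and columns of index $\ge 1$ is the Riordan matrix $(g,F)$. In particular $(1,g,F)=[1]\oplus(g,F)$. *)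

(* Defs.v *)
From HB Require Import structures.
From mathcomp Require Import all_boot all_order all_algebra.
From mathcomp Require Import complex.
From mathcomp Require Import boolp classical_sets reals.
Set Implicit Arguments.
Unset Strict Implicit.
Unset Printing Implicit Defensive.
Import Order.TTheory GRing.Theory Num.Theory.
Local Open Scope classical_set_scope.
Local Open Scope ring_scope.

Variant scalar_kind := RealScalars | ComplexScalars.

Definition scalar_field (R : realType) (k : scalar_kind) : fieldType :=
  match k with RealScalars => R | ComplexScalars => R[i] end.

(* Formal power series with coefficients in K; [s n] is the coefficient of
   x^n in s. A record is used rather than the bare function type because
   the latter already carries the pointwise product. *)
Record fps (K : fieldType) := Fps { fps_coef :> nat -> K }.

Lemma fpsP (K : fieldType) (s t : fps K) : s =1 t -> s = t.
Proof. by case: s t => [s] [t] /= /funext ->. Qed.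

HB.instance Definition _ (K : fieldType) := gen_eqMixin (fps K).
HB.instance Definition _ (K : fieldType) := gen_choiceMixin (fps K).

Definition fps0 (K : fieldType) : fps K := Fps (fun=> 0).
Definition fps_opp (K : fieldType) (s : fps K) : fps K :=
  Fps (fun n => - s n).
Definition fps_add (K : fieldType) (s t : fps K) : fps K :=
  Fps (fun n => s n + t n).
Definition fps1 (K : fieldType) : fps K := Fps (fun n => (n == 0%N)%:R).
Definition fps_mul (K : fieldType) (s t : fps K) : fps K :=
  Fps (fun n => \sum_(i < n.+1) s i * t (n - i)%N).

Lemma fps_addA (K : fieldType) : associative (@fps_add K).
Proof. by move=> s t u; apply: fpsP => n /=; rewrite addrA. Qed.
Lemma fps_addC (K : fieldType) : commutative (@fps_add K).
Proof. by move=> s t; apply: fpsP => n /=; rewrite addrC. Qed.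
Lemma fps_add0 (K : fieldType) : left_id (fps0 K) (@fps_add K).
Proof. by move=> s; apply: fpsP => n /=; rewrite add0r. Qed.
Lemma fps_addN (K : fieldType) :
  left_inverse (fps0 K) (@fps_opp K) (@fps_add K).
Proof. by move=> s; apply: fpsP => n /=; rewrite addNr. Qed.

HB.instance Definition _ (K : fieldType) :=
  GRing.isZmodule.Build (fps K)
    (@fps_addA K) (@fps_addC K) (@fps_add0 K) (@fps_addN K).

Definition fps_trunc (K : fieldType) (N : nat) (s : fps K) : {poly K} :=
  \poly_(i < N.+1) s i.

Lemma fps_truncE (K : fieldType) (N n : nat) (s : fps K) :
  (n <= N)%N -> (fps_trunc N s)`_n = s n.
Proof. by move=> nN; rewrite coef_poly ltnS nN. Qed.

Lemma fps_mul_trunc (K : fieldType) (N n : nat) (s t : fps K) :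
  (n <= N)%N -> fps_mul s t n = (fps_trunc N s * fps_trunc N t)`_n.
Proof.
move=> nN; rewrite coefM; apply: eq_bigr => i _ /=.
rewrite !fps_truncE //; first exact: leq_trans (leq_subr _ _) nN.
by apply: leq_trans nN; rewrite -ltnS.
Qed.

Lemma fps_mulC (K : fieldType) : commutative (@fps_mul K).
Proof.
by move=> s t; apply: fpsP => n; rewrite !(fps_mul_trunc _ _ (leqnn n)) mulrC.
Qed.

Lemma fps_mulA (K : fieldType) : associative (@fps_mul K).
Proof.
have E (s t u : fps K) n : fps_mul (fps_mul s t) u n =
    (fps_trunc n s * fps_trunc n t * fps_trunc n u)`_n.
  rewrite coefM; apply: eq_bigr => i _.
  by rewrite fps_truncE ?leq_subr// (@fps_mul_trunc _ n)// -ltnS.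
move=> s t u; apply: fpsP => n.
by rewrite fps_mulC !E mulrC mulrA.
Qed.

Lemma fps_mul1 (K : fieldType) : left_id (fps1 K) (@fps_mul K).
Proof.
move=> s; apply: fpsP => n /=.
rewrite big_ord_recl /= mul1r subn0 big1 ?addr0// => i _.
by rewrite mul0r.
Qed.

Lemma fps_mulDl (K : fieldType) : left_distributive (@fps_mul K) (@fps_add K).
Proof.
move=> s t u; apply: fpsP => n /=; rewrite -big_split /=.
by apply: eq_bigr => i _; rewrite mulrDl.
Qed.

Lemma fps1_neq0 (K : fieldType) : fps1 K != 0.
Proof.
apply/eqP => /(congr1 (fun s : fps K => s 0%N)) /eqP.
by rewrite /= oner_eq0.
Qed.

HB.instance Definition _ (K : fieldType) :=
  GRing.Zmodule_isComNzRing.Build (fps K)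
    (@fps_mulA K) (@fps_mulC K) (@fps_mul1 K) (@fps_mulDl K) (fps1_neq0 K).

Definition fpsX (K : fieldType) : fps K := Fps (fun n => (n == 1%N)%:R).

(* The quotient s / x; only meaningful when s has zero constant term, see
   [mul_fpsX_div]. *)
Definition fps_divX (K : fieldType) (s : fps K) : fps K :=
  Fps (fun n => s n.+1).

Definition F0 (K : fieldType) : set (fps K) := [set a | a 0%N != 0].
Definition F1 (K : fieldType) : set (fps K) :=
  [set fpsX K * a | a in @F0 K].

Lemma fpsX_mulE (K : fieldType) (s : fps K) (n : nat) :
  (fpsX K * s) n = if n is m.+1 then s m else 0.
Proof.
rewrite [LHS]/=; case: n => [|n]; first by rewrite big_ord1 mul0r.
rewrite 2!big_ord_recl /= mul0r add0r mul1r subSS subn0 big1 ?addr0// => i _.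
by rewrite mul0r.
Qed.

Lemma mul_fpsX_div (K : fieldType) (s : fps K) :
  s 0%N = 0 -> fpsX K * fps_divX s = s.
Proof. by move=> s0; apply: fpsP => -[|n]; rewrite fpsX_mulE. Qed.

Lemma F1_coef0 (K : fieldType) (s : fps K) : F1 s -> s 0%N = 0.
Proof. by case=> a _ <-; rewrite fpsX_mulE. Qed.

Definition inf_matrix (K : fieldType) := nat -> nat -> K.

Definition lower_triangular (K : fieldType) (A : inf_matrix K) : Prop :=
  forall i j, (i < j)%N -> A i j = 0.

(* Product of infinite lower triangular matrices: when A is lower triangular,
   the terms A i k * B k j with k > i of the full row-by-column sum vanish. *)
Definition ltmx_mul (K : fieldType) (A B : inf_matrix K) : inf_matrix K :=
  fun i j => \sum_(k < i.+1) A i k * B k j.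

Definition riordan (K : fieldType) (g F : fps K) : inf_matrix K :=
  fun i j => (g * F ^+ j) i.

Definition almost_riordan (K : fieldType) (a g F : fps K) : inf_matrix K :=
  fun i j => match i, j with
             | i, 0%N => a i
             | 0%N, _.+1 => 0
             | i'.+1, j'.+1 => riordan g F i' j'
             end.

Definition riordan_matrices (K : fieldType) : set (inf_matrix K) :=
  [set A | exists g F, [/\ F0 g, F1 F & A = riordan g F]].

Definition almost_riordan_matrices (K : fieldType) : set (inf_matrix K) :=
  [set A | exists a g F, [/\ F0 a, F0 g, F1 F & A = almost_riordan a g F]].

Lemma riordan_lower_triangular (K : fieldType) (g F : fps K) :
  F1 F -> lower_triangular (riordan g F).
Proof.
move=> [h _ <-] i j; rewrite /riordan exprMn mulrCA; move: (g * h ^+ j) => u.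
elim: j i => [//|j IHj] [|i] ij; rewrite exprS -mulrA fpsX_mulE //.
exact: IHj.
Qed.

Lemma almost_riordan_lower_triangular (K : fieldType) (a g F : fps K) :
  F1 F -> lower_triangular (almost_riordan a g F).
Proof.
by move=> hF [|i] [|j] //= ij; apply: riordan_lower_triangular.
Qed.

(* Main.v *)
Require Import Defs.
From HB Require Import structures.
From mathcomp Require Import all_boot all_order all_algebra.
From mathcomp Require Import complex.
From mathcomp Require Import boolp classical_sets reals.
Set Implicit Arguments.
Unset Strict Implicit.
Unset Printing Implicit Defensive.
Import Order.TTheory GRing.Theory Num.Theory.
Local Open Scope ring_scope.

(** The factorization is checked column by column.  Column 0 of the right-hand
factor is the first unit vector, so column 0 of the product is that of the
left-hand factor, namely [g].  For column [j + 1], the Riordan matrix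
[(h, x)] is the Toeplitz matrix of [h] ([riordan_fpsX]), so it acts on a column
as multiplication by [h] acts on its generating function ([riordan_fpsX_mul]).
With [h = F/x], column [j] of [(g, F)], whose generating function is [g F^j],
becomes [(F/x) g F^j]; the shift by one row caused by the bordering multiplies
it by [x], and the result is [g F^(j+1)]. *)

Lemma fpsXn_mulE (K : fieldType) (j : nat) (s : fps K) (i : nat) :
  (fpsX K ^+ j * s) i = if (j <= i)%N then s (i - j)%N else 0.
Proof.
elim: j i => [|j IHj] i; first by rewrite expr0 mul1r subn0.
by rewrite exprS -mulrA fpsX_mulE; case: i => [|i] //; rewrite IHj.
Qed.

Lemma riordan_fpsX (K : fieldType) (h : fps K) (i j : nat) :
  (j <= i)%N -> riordan h (fpsX K) i j = h (i - j)%N.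
Proof. by move=> ji; rewrite /riordan mulrC fpsXn_mulE ji. Qed.

(** The action of [(h, x)] on a column with generating function [s]; the sum
may stop at [k = i] because [(h, x)] is lower triangular. *)
Lemma riordan_fpsX_mul (K : fieldType) (h s : fps K) (i : nat) :
  \sum_(k < i.+1) riordan h (fpsX K) i k * s k = (h * s) i.
Proof.
rewrite mulrC; apply: eq_bigr => k _.
by rewrite riordan_fpsX 1?mulrC // -ltnS.
Qed.

Lemma F0_1 (K : fieldType) : F0 (1 : fps K).
Proof. exact: oner_neq0. Qed.

Lemma F1_fpsX (K : fieldType) : F1 (fpsX K).
Proof. by exists 1; [exact: F0_1 | rewrite mulr1]. Qed.

Lemma fps_divXK (K : fieldType) (s : fps K) : fps_divX (fpsX K * s) = s.
Proof. by apply: fpsP => n; exact: (fpsX_mulE s n.+1). Qed.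

Lemma F0_divX (K : fieldType) (F : fps K) : F1 F -> F0 (fps_divX F).
Proof. by move=> [a a0 <-]; rewrite fps_divXK. Qed.

Lemma riordan_factorization (K : fieldType) (g F : fps K) : F1 F ->
  riordan g F = ltmx_mul (almost_riordan g (fps_divX F) (fpsX K))
                         (almost_riordan 1 g F).
Proof.
move=> hF; apply/funext => i; apply/funext => -[|j]; rewrite /ltmx_mul.
  rewrite /riordan expr0 mulr1 big_ord_recl big1 => [|k _].
    by case: i => [|i]; rewrite /= mulr1 addr0.
  by rewrite /= mulr0.
case: i => [|i].
  by rewrite big_ord1 mulr0 riordan_lower_triangular.
(* Row 0 of the right-hand factor vanishes outside column 0, so the term [k = 0]
   drops out and the bordered blocks are multiplied. *)
rewrite big_ord_recl mulr0 add0r /=.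
rewrite (riordan_fpsX_mul _ (g * F ^+ j)) /riordan.
by rewrite exprS -{1}(mul_fpsX_div (F1_coef0 hF)) mulrCA -mulrA fpsX_mulE
  mulrCA.
Qed.

Theorem theorem2p1 (R : realType) (k : scalar_kind)
    (g F : fps (scalar_field R k)) (hg : F0 g) (hF : F1 F) :
  [/\ riordan_matrices (riordan g F),
      almost_riordan_matrices (almost_riordan g (fps_divX F) (fpsX _)),
      almost_riordan_matrices (almost_riordan 1 g F)
    & riordan g F =
        ltmx_mul (almost_riordan g (fps_divX F) (fpsX _))
                 (almost_riordan 1 g F)].
Proof.
split.
- by exists g, F.
- exists g, (fps_divX F), (fpsX _).
  by split=> //; [exact: F0_divX | exact: F1_fpsX].
- by exists 1, g, F; split=> //; exact: F0_1.
- exact: riordan_factorization.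
Qed.
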